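(* The sequence $b_{1,2}(n)$ satisfies $b_{1,2}(1)=0$, $b_{1,2}(2)=1$, and for every integer $n\ge3$, $$b_{1,2}(n)=b_{1,2}(n-1)+b_{1,2}\left(\left\lfloor \tfrac{n+1}{2}\right\rfloor\right)+b_{1,2}\left(\left\lceil \tfrac{n+1}{2}\right\rceil\right).$$
   Context: A partition $\lambda=(\lambda_1,\dots,\lambda_\ell)$ of $n$ is a weakly decreasing sequence of positive integers with sum $n$, identified with its multiset of parts; $\ell(\lambda)=\ell$ is its length. A binary partition is a partition all of whose parts are powers of $2$ (including $2^0=1$), and $\mathcal B(n)$ is the set of binary partitions of $n$. For a partition $\lambda$ with $\ell(\lambda)\ge2$, $\mathrm{pre}_2(\lambda)$ is the partition whose multiset of parts is $\{\lambda_i\lambda_k\mid 1\le i<k\le\ell(\lambda)\}$ (with multiplicity, one part for each pair $i<k$); if $\ell(\lambda)<2$, $\mathrm{pre}_2(\lambda)=\emptyset$. $\mathrm{pre}_2(\mathcal B(n))$ is the set of partitions $\mathrm{pre}_2(\lambda)$ with $\lambda\in\mathcal B(n)$. $b_{1,2}(n)$ is the total number of parts equal to $1$ (counted with multiplicity) in all partitions in $\mathrm{pre}_2(\mathcal B(n))$. *)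

(* Defs.v *)
From mathcomp Require Import all_boot.
From mathcomp Require Import boolp classical_sets cardinality fsbigop.

Set Implicit Arguments.
Unset Strict Implicit.
Unset Printing Implicit Defensive.

Local Open Scope classical_set_scope.
Local Open Scope nat_scope.

(* A partition is represented by its weakly decreasing sequence of parts, so
   that equality of sequences is equality of multisets of parts. *)
Definition is_partition (n : nat) (l : seq nat) : bool :=
  [&& sorted geq l, all (leq 1) l & sumn l == n].

Definition binary_partitions (n : nat) : set (seq nat) :=
  [set l | is_partition n l /\ forall m, m \in l -> exists k, m = 2 ^ k].

(* Parts are numbered from 0; there is one product per pair of positions
   i < k, hence none at all when size l < 2. *)
Definition pre2 (l : seq nat) : seq nat :=
  sort geq
    [seq nth 0 l i * nth 0 l k | k <- iota 0 (size l), i <- iota 0 k].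

(* The sum ranges over the image as a set: a partition arising from several
   elements of binary_partitions n would be counted once. The image is finite
   by finite_pre2_binary_partitions below, so the finitely supported sum never
   takes its default value for infinite supports. *)
Definition b12 (n : nat) : nat :=
  \big[addn/0]_(mu \in pre2 @` binary_partitions n) count_mem 1 mu.

Lemma finite_binary_partitions (n : nat) : finite_set (binary_partitions n).
Proof.
apply: (@sub_finite_set _ _
  ((fun t : n.-bseq 'I_n.+1 => map val t) @` [set: n.-bseq 'I_n.+1])).
  move=> l [/and3P[_ pos /eqP suml] _] /=.
  have szl : size l <= n.
    rewrite -suml; elim: l pos {suml} => //= a l IH /andP[a0 /IH {}IH].
    by rewrite -add1n leq_add.
  have len : all (fun m => m < n.+1) l.
    apply/allP => m ml; rewrite ltnS -suml sumnE.
    by rewrite (big_rem m ml) /= leq_addr.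
  have szb : size (map (@inord n) l) <= n by rewrite size_map.
  exists (Bseq szb) => //=; rewrite -map_comp.
  by rewrite -[RHS]map_id; apply/eq_in_map => m /(allP len) /= /inordK.
exact/finite_image/finite_finset.
Qed.

Lemma finite_pre2_binary_partitions (n : nat) :
  finite_set (pre2 @` binary_partitions n).
Proof. exact/finite_image/finite_binary_partitions. Qed.

(* Main.v *)
(** Let F r n be the sum of 'C(m(l), r) over the binary partitions l of n, where
m(l) is the number of ones of l. A pair of parts has product 1 exactly when
both are ones, so pre2 l has 'C(m(l), 2) ones. Moreover l is determined by
pre2 l as soon as l contains a one: if two such partitions differ, cancel their
common smallest parts (among which is a one); the smallest remaining part a, say
of l, then occurs as a * 1 in pre2 l, while all products left on the other side
exceed a. Hence b12 n = F 2 n.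

A binary partition of n + 1 is either a binary partition of n with a one added
or, for n odd, the double of a binary partition of (n + 1) / 2. This gives
recurrences for F 0, F 1 and F 2, and the claim reduces to
F 1 (n - 1) = F 2 (floor ((n + 1) / 2)) + F 2 (ceil ((n + 1) / 2)),
which follows by induction. *)

Require Import Defs.
From mathcomp Require Import all_boot zify.
From mathcomp Require Import boolp classical_sets functions cardinality fsbigop.

Set Implicit Arguments.
Unset Strict Implicit.
Unset Printing Implicit Defensive.

(** * Products of pairs of parts, as unsorted lists *)

Definition pair_products (l : seq nat) : seq nat :=
  [seq nth 0 l i * nth 0 l k | k <- iota 0 (size l), i <- iota 0 k].

(** The largest index [k] contributes its block of products at the very end, so appending a part
    gives an equality of lists; hence the inductions from the right. *)
Lemma pair_products_rcons l x :
  pair_products (rcons l x) = pair_products l ++ [seq y * x | y <- l].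
Proof.
rewrite /pair_products size_rcons -addn1 iotaD map_cat flatten_cat /= cats0.
congr (flatten _ ++ _).
  apply/eq_in_map => k; rewrite mem_iota add0n => /= kl.
  apply/eq_in_map => i; rewrite mem_iota add0n => /= ik.
  by rewrite !nth_rcons kl (ltn_trans ik kl).
rewrite add0n -[in RHS](mkseq_nth 0 l) /mkseq -map_comp.
apply/eq_in_map => i; rewrite mem_iota add0n => /= il.
by rewrite !nth_rcons il ltnn eqxx.
Qed.

Lemma perm_pair_products_cat s t :
  perm_eq (pair_products (s ++ t))
    (pair_products s ++ [seq x * y | x <- s, y <- t] ++ pair_products t).
Proof.
elim/last_ind: t => [|t a IH]; first by rewrite allpairs0r !cats0.
rewrite -rcons_cat !pair_products_rcons map_cat.
have /permP st_a : perm_eq [seq x * y | x <- s, y <- rcons t a]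
    ([seq x * y | x <- s, y <- t] ++ [seq x * a | x <- s]).
  exact/permPl/(allpairs_rconsr _ _ (fun=> a) (fun=> t)).
move/permP: IH => IH; apply/permP => P.
by rewrite !count_cat IH st_a !count_cat; lia.
Qed.

(** A new last part [x] adds the products [y * x], equal to 1 only if [x] and [y] are both ones; the
    count then follows Pascal's rule. *)
Lemma count_pair_products l :
  count_mem 1 (pair_products l) = 'C(count_mem 1 l, 2).
Proof.
elim/last_ind: l => [//|l x IH]; rewrite pair_products_rcons count_cat IH.
rewrite -cats1 count_cat count_map /= addn0.
case: (eqVneq x 1) => [->|x1].
  rewrite addn1 binS bin1; congr (_ + _); apply: eq_count => y /=.
  by rewrite muln1.
rewrite !addn0 -[RHS]addn0; congr (_ + _).
rewrite -[RHS](count_pred0 l); apply: eq_count => y /=.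
by rewrite muln_eq1 (negbTE x1) andbF.
Qed.

(** * Recovering a partition from its products *)

Lemma pair_productsP l z : z \in pair_products l ->
  exists x y, [/\ x \in l, y \in l & z = x * y].
Proof.
case/allpairsPdep => k [i []]; rewrite !mem_iota /= !add0n => kl ik ->.
exists (nth 0 l i), (nth 0 l k).
by split=> //; apply/mem_nth => //; apply: ltn_trans kl.
Qed.

(** Products within [r] cancel. On the left [a] remains, as [a * 1]; on the right every remaining
    product has a factor from [t], above [a], and a positive cofactor. *)
Lemma pair_products_min s t r a :
    all (leq 1) r -> 1 \in r -> all (ltn a) t ->
  ~~ perm_eq (pair_products (rcons s a ++ r)) (pair_products (t ++ r)).
Proof.
move=> r0 r1 ta; apply/negP => st.
have {st} : perm_eq
    (pair_products (rcons s a) ++ [seq x * y | x <- rcons s a, y <- r])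
    (pair_products t ++ [seq x * y | x <- t, y <- r]).
  rewrite -(perm_cat2r (pair_products r)) -!catA.
  rewrite -(permPl (perm_pair_products_cat _ _)).
  by rewrite -(permPr (perm_pair_products_cat _ _)).
move/perm_mem/(_ a); rewrite !mem_cat => /esym.
have -> : a \in [seq x * y | x <- rcons s a, y <- r].
  by apply/allpairsP; exists (a, 1); rewrite mem_rcons mem_head muln1.
rewrite orbT => /orP[/pair_productsP[x [y []]]|].
  by move=> /(allP ta) /= ax /(allP ta) /= ay; nia.
case/allpairsP => -[x y] /= [] /(allP ta) /= ax /(allP r0) /= ay; nia.
Qed.

(** Here [r] collects the common smallest parts cancelled so far; as the lists decrease, the next
    smallest part is the last entry. *)
Lemma pair_products_cat_inj s t r :
    pairwise geq s -> pairwise geq t -> all (leq 1) (s ++ r) ->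
    all (leq 1) (t ++ r) -> 1 \in r ->
  perm_eq (pair_products (s ++ r)) (pair_products (t ++ r)) -> s = t.
Proof.
elim/last_ind: s t r => [|s a IH] t r; case/lastP: t => [|t b] //.
- move=> _ _ r0 _ r1; rewrite perm_sym => st.
  by have := pair_products_min t r0 r1 (isT : all (ltn b) [::]); rewrite st.
- move=> _ _ _ r0 r1 st.
  by have := pair_products_min s r0 r1 (isT : all (ltn a) [::]); rewrite st.
(* If the smallest part exceeds [d], all parts do, as [pair_products_min] requires. *)
have gt c d u : all (geq^~ c) u -> d < c -> all (ltn d) (rcons u c).
  move=> uc dc; rewrite all_rcons /= dc; apply: sub_all uc => x /=.
  exact: leq_trans.
rewrite !pairwise_rcons => /andP[sa s0] /andP[tb t0] sr tr r1 st.
have r0 : all (leq 1) r by move: sr; rewrite all_cat => /andP[].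
have [ab|ba|ab] := ltngtP a b.
- by have := pair_products_min s r0 r1 (gt _ _ _ tb ab); rewrite st.
- have := pair_products_min t r0 r1 (gt _ _ _ sa ba).
  by rewrite perm_sym st.
rewrite -ab !cat_rcons in sr tr st *.
by rewrite (IH t (a :: r)) // inE r1 orbT.
Qed.

Lemma rcons_one l : pairwise geq l -> all (leq 1) l -> 1 \in l ->
  exists s, l = rcons s 1.
Proof.
case/lastP: l => // s a; rewrite pairwise_rcons all_rcons mem_rcons inE.
move=> /andP[/allP sa _] /andP[a0 _] /orP[/eqP<-|/sa /= a1]; first by exists s.
by exists s; congr rcons; apply/eqP; rewrite eqn_leq a1.
Qed.

(** Both lists end in a one, so the cancellation can start with [r] equal to [[:: 1]]. *)
Lemma pair_products_inj s t :
    pairwise geq s -> pairwise geq t -> all (leq 1) s -> all (leq 1) t ->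
    1 \in s -> 1 \in t ->
  perm_eq (pair_products s) (pair_products t) -> s = t.
Proof.
move=> ss ts s0 t0 s1 t1.
have [s' es] := rcons_one ss s0 s1; have [t' et] := rcons_one ts t0 t1.
move: ss ts s0 t0; rewrite {s1 t1}es {}et.
rewrite !pairwise_rcons -!cats1 => /andP[_ ss] /andP[_ ts] s0 t0 st.
by rewrite (pair_products_cat_inj ss ts s0 t0 _ st).
Qed.

(** * Reduction of [b12] to a sum of binomial coefficients *)

Local Open Scope classical_set_scope.
Local Open Scope nat_scope.

Lemma binary_partitionsP n l : binary_partitions n l <->
  [/\ pairwise geq l, all (leq 1) l, sumn l = n
    & forall m, m \in l -> exists k, m = 2 ^ k].
Proof.
have geq_trans : transitive geq by move=> x y z /= xy yz; apply: leq_trans xy.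
rewrite /binary_partitions /is_partition /= sorted_pairwise //.
by split=> [[/and3P[? ? /eqP ?] ?]|[-> -> /eqP -> ?]].
Qed.

Definition binomial_sum (r n : nat) : nat :=
  \big[addn/0]_(l \in binary_partitions n) 'C(count_mem 1 l, r).

Lemma b12E n : b12 n = binomial_sum 2 n.
Proof.
have countE l : count_mem 1 (pre2 l) = 'C(count_mem 1 l, 2).
  by rewrite -count_pair_products; apply/permP/permPl/perm_sort.
(* Partitions without a one contribute 0, so both sums restrict to [A], on which [pre2] is
   injective. *)
pose A := binary_partitions n `&` [set l | 1 \in l].
have A0 l : (binary_partitions n `\` A) l -> count_mem 1 (pre2 l) = 0.
  move=> [Bl Al]; rewrite countE.
  have : ~~ (1 \in l) by apply/negP => l1; apply: Al.
  by rewrite -has_pred1 has_count -leqNgt leqn0 => /eqP ->.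
rewrite /b12 -(fsbig_widen (pre2 @` A)); first last.
- move=> _ [[l Bl <-] Al] /=; by apply: A0; split.
- by apply: image_subset => l [].
rewrite fsbig_image.
  rewrite (fsbig_widen A (binary_partitions n)) //; last by move=> l [].
  by apply: eq_fsbigr => l _.
move=> s t /set_mem[/binary_partitionsP[ss s0 _ _] s1].
move=> /set_mem[/binary_partitionsP[ts t0 _ _] t1] st.
apply: pair_products_inj => //.
rewrite -(permPl (permEl (perm_sort geq _))) -[sort _ _]/(pre2 s) st.
by rewrite perm_sort.
Qed.

(** * Recursive structure of binary partitions *)

Lemma binary_partitions0 : binary_partitions 0 = [set [::]].
Proof.
apply/seteqP; split=> [l /binary_partitionsP[_]|l -> /=]; last first.
  exact/binary_partitionsP.
by case: l => [//|[|a] l].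
Qed.

Lemma sumn_map_double s : sumn (map double s) = (sumn s).*2.
Proof. by elim: s => //= a s ->; rewrite doubleD. Qed.

(** Powers of 2 other than one are even: without ones, every part can be halved, and the sum [n.+1]
    is even. *)
Lemma binary_partitionsS n : binary_partitions n.+1 =
  (rcons^~ 1) @` binary_partitions n `|`
  map double @` (if odd n then binary_partitions n.+1./2 else set0).
Proof.
apply/seteqP; split=> l.
  move=> /binary_partitionsP[ls l0 ln l2]; case: (boolP (1 \in l)) => l1.
    have [s es] := rcons_one ls l0 l1; left; exists s => //.
    subst l; move: ls l0 ln l2 {l1}.
    rewrite pairwise_rcons all_rcons sumn_rcons addn1.
    move=> /andP[_ ss] /andP[_ s0] [sn] s2.
    apply/binary_partitionsP; split=> // m ms.
    by apply: s2; rewrite mem_rcons inE ms orbT.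
  have {l1}l2 m : m \in l -> exists k, m = (2 ^ k).*2.
    move=> ml; have [[|k] mk] := l2 m ml; last by exists k; rewrite mk expnS mul2n.
    by rewrite mk in ml; rewrite ml in l1.
  have el : l = map double (map half l).
    rewrite -map_comp -[LHS]map_id; apply/eq_in_map => m /l2[k ->] /=.
    by rewrite doubleK.
  right; exists (map half l) => //.
  have -> : odd n.
    move: (congr1 odd ln).
    by rewrite el sumn_map_double odd_double /= => /esym/negbFE.
  apply/binary_partitionsP; split.
  - by rewrite pairwise_map; apply: sub_pairwise ls => x y; apply: half_leq.
  - by apply/allP => _ /mapP[m /l2[k ->] ->]; rewrite doubleK expn_gt0.
  - by rewrite -ln {2}el sumn_map_double doubleK.
  - by move=> _ /mapP[m /l2[k ->] ->]; exists k; rewrite doubleK.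
case=> -[s + <-].
  move=> /binary_partitionsP[ss s0 sn s2]; apply/binary_partitionsP; split.
  - by rewrite pairwise_rcons ss andbT.
  - by rewrite all_rcons.
  - by rewrite sumn_rcons sn addn1.
  - by move=> m; rewrite mem_rcons inE => /orP[/eqP->|/s2//]; exists 0.
case: ifP => // on /binary_partitionsP[ss s0 sn s2].
apply/binary_partitionsP; split.
- by rewrite pairwise_map; apply: sub_pairwise ss => x y /=; rewrite leq_double.
- by rewrite all_map; apply: sub_all s0 => x /=; rewrite double_gt0.
- by rewrite sumn_map_double sn even_halfK //= on.
- by move=> _ /mapP[m /s2[k ->] ->]; exists k.+1; rewrite expnS mul2n.
Qed.

(** * Recurrences for the binomial sums *)

Lemma binomial_sum0 r : binomial_sum r 0 = (r == 0).
Proof. by rewrite /binomial_sum binary_partitions0 fsbig_set1 bin0n. Qed.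

Lemma fsbig_binary_partitionsS (f : seq nat -> nat) n :
  \big[addn/0]_(l \in binary_partitions n.+1) f l =
  \big[addn/0]_(l \in binary_partitions n) f (rcons l 1) +
  (if odd n then \big[addn/0]_(l \in binary_partitions n.+1./2) f (map double l)
   else 0).
Proof.
set C := if odd n then binary_partitions n.+1./2 else set0.
have finC : finite_set C.
  by rewrite /C; case: ifP => _ //; apply: finite_binary_partitions.
rewrite binary_partitionsS -/C fsbigU0; first last.
(* The two images are disjoint, since a doubled partition contains no one. *)
- move=> _ [[s _ <-] [t _ ts]].
  have : 1 \in map double t by rewrite ts mem_rcons mem_head.
  by case/mapP => x _; case: x.
- exact: finite_image.
- exact/finite_image/finite_binary_partitions.
rewrite !fsbig_image; first last.
- by move=> s t _ _ /rcons_inj[].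
- by move=> s t _ _; apply: inj_map; apply: double_inj.
by congr (_ + _); rewrite /C; case: ifP; rewrite ?fsbig_set0.
Qed.

(** Pascal's rule accounts for the added one; doubled partitions have no ones and ['C(0, r.+1)] is
    0. *)
Lemma binomial_sumS r n :
  binomial_sum r.+1 n.+1 = binomial_sum r.+1 n + binomial_sum r n.
Proof.
rewrite /binomial_sum fsbig_binary_partitionsS.
rewrite -fsbig_split; last exact: finite_binary_partitions.
rewrite -[RHS]addn0; congr (_ + _).
  by apply: eq_fsbigr => l _; rewrite -cats1 count_cat /= addn1 binS.
case: ifP => // _; apply: fsbig1 => l _.
suff -> : count_mem 1 (map double l) = 0 by [].
by rewrite count_map -[RHS](count_pred0 l); apply: eq_count; case.
Qed.

Lemma binomial_sum0S n : binomial_sum 0 n.+1 =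
  binomial_sum 0 n + (if odd n then binomial_sum 0 n.+1./2 else 0).
Proof.
rewrite /binomial_sum fsbig_binary_partitionsS.
by congr (_ + _); [|case: ifP => // _]; apply: eq_fsbigr => l _; rewrite !bin0.
Qed.

(** All these quantities grow by [binomial_sum 0 j.+1] when [j] increases by one. *)
Lemma binomial_sum0_double j :
  binomial_sum 0 j.*2 = binomial_sum 1 j.+1 /\
  binomial_sum 0 j.*2.+1 = binomial_sum 1 j.+1.
Proof.
elim: j => [|j [_ IH]].
  by rewrite !(binomial_sum0S, binomial_sumS, binomial_sum0).
rewrite [in X in _ /\ X]binomial_sum0S odd_double addn0.
by rewrite doubleS binomial_sum0S /= odd_double /= doubleK IH -binomial_sumS.
Qed.

(** The reduced identity, split by parity. In the first equation both sides grow by [binomial_sum 1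
    j.+1 + binomial_sum 1 j.+2] with [j]; one more recurrence step gives the second. *)
Lemma binomial_sum1_double j :
  binomial_sum 1 j.*2.+1 = binomial_sum 2 j.+1 + binomial_sum 2 j.+2 /\
  binomial_sum 1 j.*2.+2 = (binomial_sum 2 j.+2).*2.
Proof.
have [_ o] := binomial_sum0_double j.
have odd_case : binomial_sum 1 j.*2.+1 = binomial_sum 2 j.+1 + binomial_sum 2 j.+2.
  elim: j {o} => [|j IH].
    by rewrite !(binomial_sum0S, binomial_sumS, binomial_sum0).
  have [_ o] := binomial_sum0_double j; have [e _] := binomial_sum0_double j.+1.
  rewrite doubleS in e *; rewrite binomial_sumS e binomial_sumS IH o.
  by rewrite (binomial_sumS 1 j.+2) (binomial_sumS 1 j.+1); lia.
by split=> //; rewrite binomial_sumS odd_case o (binomial_sumS 1 j.+1); lia.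
Qed.

Theorem theorem11 :
  [/\ b12 1 = 0,
      b12 2 = 1
    & forall n : nat, 3 <= n ->
        b12 n = b12 n.-1 + b12 (n.+1)./2 + b12 (uphalf n.+1)].
Proof.
split; rewrite ?b12E.
- by rewrite binomial_sumS !binomial_sum0.
- by rewrite !(binomial_sum0S, binomial_sumS, binomial_sum0).
case=> [//|[//|n]] _; rewrite !b12E /= binomial_sumS -addnA; congr (_ + _).
(* Now [n] is the original index minus 2. For odd [n], floor and ceiling both equal [n./2.+2],
   whence the doubled term. *)
rewrite -[n in LHS]odd_double_half uphalf_half.
have [e o] := binomial_sum1_double n./2.
by case: (odd n); rewrite ?add0n ?add1n ?o ?addnn // e.
Qed.
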